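(* Let $J$ be a Jacobi-Jordan conformal algebra and $K$ an $\mathbb{F}[\partial]$-module. Set $E=J\oplus K$, the direct sum of $\mathbb{F}[\partial]$-modules. Let $\mathcal{S}(J,K)$ be the set of all Jacobi-Jordan conformal extending structures of $J$ through $K$. Then: 1. With $\mathcal{H}^2_J(K,J):=\mathcal{S}(J,K)/\equiv$, the map $\mathcal{H}^2_J(K,J)\to \mathrm{CExtd}(E,J)$ sending the equivalence class of $\mathcal{U}(J,K)$ with respect to $\equiv$ to the class of the corresponding unified product $(J\natural K,\ast_\lambda)$ is bijective. 2. With $\mathcal{H}^2(K,J):=\mathcal{S}(J,K)/\approx$, the map $\mathcal{H}^2(K,J)\to \mathrm{CExtd}'(E,J)$ sending the equivalence class of $\mathcal{U}(J,K)$ with respect to $\approx$ to the class of the corresponding unified product $(J\natural K,\ast_\lambda)$ is bijective.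
   Context: $\mathbb{F}$ is a field of characteristic $0$. A conformal algebra is an $\mathbb{F}[\partial]$-module $A$ with an $\mathbb{F}$-bilinear $\lambda$-product $A\times A\to A[\lambda]$, $(a,b)\mapsto a_\lambda b$, with $(\partial a)_\lambda b=-\lambda\,a_\lambda b$ and $a_\lambda(\partial b)=(\lambda+\partial)(a_\lambda b)$. A Jacobi-Jordan conformal algebra is a conformal algebra with $a_\lambda b=b_{-\lambda-\partial}a$ and $a_\lambda(b_\mu c)+(a_\lambda b)_{\lambda+\mu}c+b_\mu(a_\lambda c)=0$ for all $a,b,c$. For $\mathbb{F}[\partial]$-modules $M,N,P$, a conformal bilinear map $f_\lambda:M\times N\to P[\lambda]$ is an $\mathbb{F}$-bilinear map with $f_\lambda(\partial u,v)=-\lambda f_\lambda(u,v)$, $f_\lambda(u,\partial v)=(\lambda+\partial)f_\lambda(u,v)$. Substituting $-\lambda-\partial$ for $\lambda$ in $\sum_n\lambda^n p_n$ means $\sum_n(-\lambda-\partial)^np_n$. An extending datum of $J$ by $K$ is a system $\mathcal{U}(J,K)=\{\lhd_\lambda,\rhd_\lambda,\omega_\lambda,\circ_\lambda\}$ of conformal bilinear maps $\lhd_\lambda:K\times J\to K[\lambda]$, $\rhd_\lambda:K\times J\to J[\lambda]$, $\omega_\lambda:K\times K\to J[\lambda]$, $\circ_\lambda:K\times K\to K[\lambda]$. $J\natural K$ denotes the $\mathbb{F}[\partial]$-module $J\oplus K$ with $$(a,x)\ast_\lambda(b,y)=(a_\lambda b+x\rhd_\lambda b+y\rhd_{-\lambda-\partial}a+\omega_\lambda(x,y),\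 x\lhd_\lambda b+y\lhd_{-\lambda-\partial}a+x\circ_\lambda y).$$ If this is a Jacobi-Jordan conformal algebra, then $J\natural K$ is called the unified product of $J$ and $K$ associated with $\mathcal{U}(J,K)$, and $\mathcal{U}(J,K)$ is called a Jacobi-Jordan conformal extending structure of $J$ through $K$. Two extending structures $\mathcal{U}(J,K)=\{\lhd_\lambda,\rhd_\lambda,\omega_\lambda,\circ_\lambda\}$ and $\mathcal{U}'(J,K)=\{\lhd'_\lambda,\rhd'_\lambda,\omega'_\lambda,\circ'_\lambda\}$ are equivalent, written $\mathcal{U}(J,K)\equiv\mathcal{U}'(J,K)$, if there are an $\mathbb{F}[\partial]$-module homomorphism $r:K\to J$ and $s\in\mathrm{Aut}_{\mathbb{F}[\partial]}(K)$ such that for all $a\in J$, $x,y\in K$: - $x\rhd_{-\lambda-\partial}a+r(x\lhd_{-\lambda-\partial}a)=a_\lambda r(x)+s(x)\rhd'_{-\lambda-\partial}a$, - $s(x\lhd_{-\lambda-\partial}a)=s(x)\lhd'_{-\lambda-\partial}a$, - $\omega_\lambda(x,y)+r(x\circ_\lambda y)=r(x)_\lambda r(y)+s(x)\rhd'_\lambda r(y)+s(y)\rhd'_{-\lambda-\partial}r(x)+\omega'_\lambda(s(x),s(y))$, - $s(x\circ_\lambda y)=s(x)\lhd'_\lambda r(y)+s(y)\lhd'_{-\lambda-\partial}r(x)+s(x)\circ'_\lambda s(y)$. They are cohomologous, written $\approx$, if this holds with $s=\mathrm{id}_K$. For $E=J\oplus K$ with inclusion $i:J\to E$ and natural projection $\pi:E\to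 K$, an $\mathbb{F}[\partial]$-module homomorphism $\varphi:E\to E$ stabilizes $J$ if $\varphi i=i$ and co-stabilizes $K$ if $\pi\varphi=\pi$. Two Jacobi-Jordan conformal algebra structures on the $\mathbb{F}[\partial]$-module $E$, both containing $J$ as a Jacobi-Jordan conformal subalgebra, are equivalent ($\equiv$) if there is a Jacobi-Jordan conformal algebra isomorphism between them stabilizing $J$, and cohomologous ($\approx$) if there is one which stabilizes $J$ and co-stabilizes $K$. $\mathrm{CExtd}(E,J)$ (resp. $\mathrm{CExtd}'(E,J)$) is the set of classes under $\equiv$ (resp. $\approx$) of all Jacobi-Jordan conformal algebra structures on $E$ containing $J$ as a Jacobi-Jordan conformal subalgebra. *)

(* Defs.v *)
From HB Require Import structures.
From mathcomp Require Import all_boot all_algebra.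
From mathcomp Require Import finmap.
From mathcomp.multinomials Require Import monalg.

Set Implicit Arguments.
Unset Strict Implicit.
Unset Printing Implicit Defensive.

Import GRing.Theory.
Local Open Scope ring_scope.

(* An F[∂]-module is an lmodType over {poly F}, ∂ being the action of 'X. *)

(* Polynomials with coefficients in an F[∂]-module A and exponents in I, with  *)
(* F[∂] acting on the coefficients. A[λ] is apol A nat, and A[λ, μ] is         *)
(* apol A (nat * nat), the exponent (i, j) standing for λ^i μ^j.               *)
Definition apol (R : nzRingType) (A : lmodType R) (I : choiceType) : Type :=
  {malg A[I]}.

HB.instance Definition _ (R : nzRingType) (A : lmodType R) (I : choiceType) :=
  GRing.Zmodule.on (apol A I).

Definition apol_map (A B : zmodType) (I : choiceType) (f : A -> B)
  (p : {malg A[I]}) : {malg B[I]} := [malg i in msupp p => f p@_i].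

Lemma apol_mapE (A B : zmodType) (I : choiceType) (f : A -> B)
  (p : {malg A[I]}) (i : I) : f 0 = 0 -> (apol_map f p)@_i = f p@_i.
Proof. by move=> f0; rewrite mcoeffE; case: msuppP => // _; rewrite f0. Qed.

Section ApolModule.
Variables (R : nzRingType) (A : lmodType R) (I : choiceType).

Definition apol_scale (c : R) (p : apol A I) : apol A I :=
  apol_map (fun a : A => c *: a) p.

Let scaleE c p i : (apol_scale c p)@_i = c *: p@_i.
Proof. by rewrite apol_mapE ?scaler0. Qed.

Fact apol_scaleA a b p : apol_scale a (apol_scale b p) = apol_scale (a * b) p.
Proof. by apply/malgP => i; rewrite !scaleE scalerA. Qed.

Fact apol_scale1 : left_id 1 apol_scale.
Proof. by move=> p; apply/malgP => i; rewrite scaleE scale1r. Qed.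

Fact apol_scaleDr : right_distributive apol_scale +%R.
Proof.
by move=> c p q; apply/malgP => i; rewrite mcoeffD !scaleE mcoeffD scalerDr.
Qed.

Fact apol_scaleDl p : {morph apol_scale^~ p : a b / a + b}.
Proof. by move=> a b; apply/malgP => i; rewrite mcoeffD !scaleE scalerDl. Qed.

HB.instance Definition _ := GRing.Zmodule_isLmodule.Build R (apol A I)
  apol_scaleA apol_scale1 apol_scaleDr apol_scaleDl.

End ApolModule.

(* The substitution  Σ_n λ^n p_n |-> Σ_n t^n (j p_n),  where t is an operator  *)
(* on V and j embeds the coefficients in V.                                    *)
Definition lsubst (A V : zmodType) (j : A -> V) (t : V -> V)
  (p : {malg A[nat]}) : V := \sum_(n <- msupp p) iter n t (j p@_n).

Definition apol_shift (A : zmodType) (I : choiceType) (h : I -> I)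
  (p : {malg A[I]}) : {malg A[I]} := \sum_(i <- msupp p) << p@_i *g h i >>.

Notation lpoly A := (apol A nat).
Notation lmpoly A := (apol A (nat * nat)%type).

Section Conformal.
Variable F : fieldType.
Implicit Types A M N P : lmodType {poly F}.

Definition lconst A (a : A) : lpoly A := << a *g 0%N >>.
Definition lam A (p : lpoly A) : lpoly A := apol_shift S p.

Definition lmconst A (a : A) : lmpoly A := << a *g (0%N, 0%N) >>.
Definition lam2 A (p : lmpoly A) : lmpoly A :=
  apol_shift (fun i => (i.1.+1, i.2)) p.
Definition mu2 A (p : lmpoly A) : lmpoly A :=
  apol_shift (fun i => (i.1, i.2.+1)) p.

(* Substitution of -λ-∂ for λ *)
Definition lopp A (p : lpoly A) : lpoly A :=
  lsubst (@lconst A) (fun q => - lam q - 'X *: q) p.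

Definition conformal_bilinear M N P (f : M -> N -> lpoly P) : Prop :=
  [/\ (forall (c : F) u u' v,
         f (c%:P *: u + u') v = c%:P *: f u v + f u' v),
      (forall (c : F) u v v',
         f u (c%:P *: v + v') = c%:P *: f u v + f u v'),
      (forall u v, f ('X *: u) v = - lam (f u v))
    & (forall u v, f u ('X *: v) = lam (f u v) + 'X *: f u v)].

Record cbilin M N P := CBilin {
  cbilin_fun :> M -> N -> lpoly P;
  cbilinP : conformal_bilinear cbilin_fun }.

(* The three terms are a_λ(b_μ c), (a_λ b)_{λ+μ} c and b_μ(a_λ c), in A[λ, μ]. *)
Definition jacobi_jordan A (m : A -> A -> lpoly A) : Prop :=
  forall a b c : A,
    lsubst (fun u => lsubst (@lmconst A) (@lam2 A) (m a u)) (@mu2 A) (m b c)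
  + lsubst (fun u => lsubst (@lmconst A) (fun q => lam2 q + mu2 q) (m u c))
      (@lam2 A) (m a b)
  + lsubst (fun u => lsubst (@lmconst A) (@mu2 A) (m b u)) (@lam2 A) (m a c)
  = 0.

Definition is_jjca A (m : A -> A -> lpoly A) : Prop :=
  [/\ conformal_bilinear m,
      (forall a b, m a b = lopp (m b a))
    & jacobi_jordan m].

Record jjca A := JJCA {
  jjca_mul :> A -> A -> lpoly A;
  jjcaP : is_jjca jjca_mul }.

End Conformal.

Section Quotient.
Variables (T : Type) (R : T -> T -> Prop).

(* The quotient set T / R of an equivalence relation R, as the set of its      *)
(* classes {y | R x y}.                                                        *)
Definition quot : Type := {C : T -> Prop | exists x, C = R x}.
Definition class (x : T) : quot := exist _ (R x) (ex_intro _ x erefl).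

End Quotient.

Section Extending.
Variables (F : fieldType) (J K : lmodType {poly F}) (mJ : jjca J).

Record extending_datum := ExtendingDatum {
  lhd : cbilin K J K;
  rhd : cbilin K J J;
  omega : cbilin K K J;
  circ : cbilin K K K }.

Local Notation E := (J * K)%type.

Definition inJ (a : J) : E := (a, 0).
Definition inK (x : K) : E := (0, x).

(* (J ⊕ K)[λ] is identified with J[λ] ⊕ K[λ] *)
Definition lpair (p : lpoly J) (q : lpoly K) : lpoly E :=
  apol_map inJ p + apol_map inK q.

Definition umul (U : extending_datum) (u v : E) : lpoly E :=
  let: (a, x) := u in let: (b, y) := v in
  lpair (mJ a b + rhd U x b + lopp (rhd U y a) + omega U x y)
        (lhd U x b + lopp (lhd U y a) + circ U x y).

Definition is_extending_structure (U : extending_datum) : Prop :=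
  is_jjca (umul U).

Record extending_structure := ExtendingStructure {
  datum :> extending_datum;
  datumP : is_extending_structure datum }.

Definition unified_product (U : extending_structure) : jjca E :=
  JJCA (datumP U).

Definition extends_J (m : jjca E) : Prop :=
  forall a b : J, m (inJ a) (inJ b) = apol_map inJ (mJ a b).

Record extension := Extension {
  ext_mul :> jjca E;
  extP : extends_J ext_mul }.

Definition compatible (U U' : extending_datum) (r : K -> J) (s : K -> K)
    : Prop :=
  forall (a : J) (x y : K),
  [/\ lopp (rhd U x a) + apol_map r (lopp (lhd U x a))
        = mJ a (r x) + lopp (rhd U' (s x) a),
      apol_map s (lopp (lhd U x a)) = lopp (lhd U' (s x) a),
      omega U x y + apol_map r (circ U x y)
        = mJ (r x) (r y) + rhd U' (s x) (r y)
          + lopp (rhd U' (s y) (r x)) + omega U' (s x) (s y)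
    & apol_map s (circ U x y)
        = lhd U' (s x) (r y) + lopp (lhd U' (s y) (r x))
          + circ U' (s x) (s y)].

Definition equiv_struct (U U' : extending_structure) : Prop :=
  exists (r : {linear K -> J}) (s : {linear K -> K}),
    bijective s /\ compatible U U' r s.

Definition cohom_struct (U U' : extending_structure) : Prop :=
  exists r : {linear K -> J}, compatible U U' r id.

Definition jjca_iso (m m' : jjca E) (phi : E -> E) : Prop :=
  bijective phi /\
  forall u v, apol_map phi (m u v) = m' (phi u) (phi v).

Definition stabilizesJ (phi : E -> E) : Prop :=
  forall a, phi (inJ a) = inJ a.
Definition costabilizesK (phi : E -> E) : Prop :=
  forall u, (phi u).2 = u.2.

Definition equiv_ext (m m' : extension) : Prop :=
  exists phi : {linear E -> E}, jjca_iso m m' phi /\ stabilizesJ phi.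

Definition cohom_ext (m m' : extension) : Prop :=
  exists phi : {linear E -> E},
    [/\ jjca_iso m m' phi, stabilizesJ phi & costabilizesK phi].

Definition H2J : Type := quot equiv_struct.
Definition H2 : Type := quot cohom_struct.
Definition CExtd : Type := quot equiv_ext.
Definition CExtd' : Type := quot cohom_ext.

Let cbilin0l (M N P : lmodType {poly F}) (f : cbilin M N P) v : f 0 v = 0.
Proof.
case: (cbilinP f) => /(_ 1 0 0 v) + _ _ _; rewrite polyC1 !scale1r addr0 => H.
by apply: (@addIr _ (f 0 v)); rewrite add0r -H.
Qed.

Let lopp0 (P : lmodType {poly F}) : lopp (0 : lpoly P) = 0.
Proof. by rewrite /lopp /lsubst msupp0 big_nil. Qed.

Lemma unified_product_extends (U : extending_structure) :
  extends_J (unified_product U).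
Proof.
move=> a b; rewrite /= /lpair !cbilin0l !lopp0 !addr0.
suff -> : apol_map inK (0 : lpoly K) = 0 by rewrite addr0.
by apply/malgP => i; rewrite apol_mapE ?mcoeff0.
Qed.

Definition unified_extension (U : extending_structure) : extension :=
  Extension (unified_product_extends U).

End Extending.

(* Main.v *)
Require Import Defs.
From HB Require Import structures.
From mathcomp Require Import all_boot all_algebra.
From mathcomp Require Import finmap.
From mathcomp.multinomials Require Import monalg.
From Stdlib Require Import FunctionalExtensionality PropExtensionality.
From Stdlib Require Import ProofIrrelevance RelationClasses.

Set Implicit Arguments.
Unset Strict Implicit.
Unset Printing Implicit Defensive.

Import GRing.Theory.
Local Open Scope ring_scope.

(** An extending datum lists the blocks of a commutative product on J ⊕ K whose
    J × J block is the product of J: ⊲ and ⊳ are the K- and J-components of the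
    K × J block, ∘ and ω those of the K × K block, and the J × K block is
    obtained from the K × J block by the substitution -λ-∂ for λ.  A
    commutative conformal bilinear product is determined by these blocks, so
    every extension m of J is, on the nose, the unified product of the datum
    read off from m ([umul_datum_of_extension]); this gives surjectivity, for
    both equivalence relations at once.

    For the comparison of relations, an F[∂]-linear map of J ⊕ K that fixes J
    pointwise is upper triangular, (a, x) ↦ (a + r x, s x)
    ([stabilizing_is_triangular]); it is bijective exactly when s is, and it
    co-stabilizes K exactly when s is the identity.  It is a morphism between
    two unified products exactly when it respects the product on J × E and on
    K × K, and comparing the J- and K-components of these two requirements
    gives the four compatibility conditions ([triangular_morphismP]).  Hence
    U ↦ J ♮ U preserves and reflects both relations, and a surjection with this
    property induces a bijection between the quotients ([quot_map_bij]).  That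
    the relations on extending structures are equivalences is pulled back from
    the relations on extensions, where isomorphisms are composed and inverted. *)

(** * Maps between quotient sets *)

Section QuotientSet.
Variables (T : Type) (R : T -> T -> Prop).

Lemma quot_eq (C D : quot R) : (forall y, sval C y <-> sval D y) -> C = D.
Proof.
move=> CD; apply: eq_sig_hprop => [E|]; first exact: proof_irrelevance.
by apply: functional_extensionality => y; apply: propositional_extensionality.
Qed.

Lemma quot_class (C : quot R) : exists x, C = class R x.
Proof. by case: C => C [x eC]; exists x; apply: quot_eq => y; rewrite /= eC. Qed.

Lemma class_eq x y : Equivalence R -> R x y -> class R x = class R y.
Proof.
case=> refl sym trans Rxy; apply: quot_eq => z /=.
by split; [apply: trans; apply: sym | exact: trans].
Qed.

End QuotientSet.

Section QuotientMap.
Variables (T T' : Type) (R : T -> T -> Prop) (S : T' -> T' -> Prop).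
Variable f : T -> T'.
Hypothesis reflects : forall x y, R x y <-> S (f x) (f y).

Lemma Equivalence_comap : Equivalence S -> Equivalence R.
Proof.
case=> refl sym trans; split=> [x|x y|x y z]; rewrite !reflects //.
- exact: sym.
- exact: trans.
Qed.

(** No representative is chosen: a class is sent to the saturation of its image,
    and the inverse is the preimage of classes along f, so that f being onto
    up to S is used only to see that this preimage is a class. *)
Lemma quot_map_bij :
    Equivalence S -> (forall y, exists x, S (f x) y) ->
  exists Phi : quot R -> quot S,
    (forall x, Phi (class R x) = class S (f x)) /\ bijective Phi.
Proof.
move=> eqS surj; have eqR := Equivalence_comap eqS.
have [reflS symS transS] := eqS; have [reflR _ _] := eqR.
have PhiP (C : quot R) : exists y, (fun z => exists2 x, sval C x & S (f x) z) = S y.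
  have [x ->] := quot_class C; exists (f x).
  apply: functional_extensionality => z; apply: propositional_extensionality.
  split=> [[x' /reflects Sxx' Sx'z]|Sxz]; first exact: transS Sxx' Sx'z.
  by exists x => //=; apply: reflR.
have PsiP (D : quot S) : exists x, (fun z => sval D (f z)) = R x.
  have [y ->] := quot_class D; have [x Sxy] := surj y; exists x.
  apply: functional_extensionality => z; apply: propositional_extensionality.
  by rewrite reflects; split; apply: transS => //; apply: symS.
pose Phi C : quot S := exist _ _ (PhiP C).
pose Psi D : quot R := exist _ _ (PsiP D).
have Phi_class x : Phi (class R x) = class S (f x).
  apply: quot_eq => z /=; split=> [[x' /reflects Sxx' Sx'z]|Sxz].
    exact: transS Sxx' Sx'z.
  by exists x => //; apply: reflR.
have Psi_class x : Psi (class S (f x)) = class R x.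
  by apply: quot_eq => z /=; rewrite reflects.
exists Phi; split=> //; exists Psi.
- by move=> C; have [x ->] := quot_class C; rewrite Phi_class Psi_class.
- move=> D; have [y ->] := quot_class D; have [x Sxy] := surj y.
  by rewrite -(class_eq eqS Sxy) Psi_class Phi_class.
Qed.

End QuotientMap.

(** * Linear maps acting on the coefficients of polynomials in λ *)

Section ApolMap.
Variable I : choiceType.

Lemma apol_map_is_additive (A B : zmodType) (f : {additive A -> B}) :
  zmod_morphism (@apol_map A B I f).
Proof.
by move=> p q; apply/malgP => i; rewrite mcoeffB !apol_mapE ?raddf0 // mcoeffB raddfB.
Qed.

HB.instance Definition _ (A B : zmodType) (f : {additive A -> B}) :=
  GRing.isZmodMorphism.Build {malg A[I]} {malg B[I]} (@apol_map A B I f)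
    (apol_map_is_additive f).

Lemma mcoeff_apolZ (R : nzRingType) (A : lmodType R) (c : R) (p : apol A I) i :
  (c *: p)@_i = c *: p@_i.
Proof. exact/apol_mapE/scaler0. Qed.

Lemma apol_mapZ (R : nzRingType) (A B : lmodType R) (f : {linear A -> B})
  (c : R) (p : apol A I) :
  apol_map f (c *: p) = c *: (apol_map f p : apol B I).
Proof.
apply/malgP => i; rewrite mcoeff_apolZ !(apol_mapE _ _ (raddf0 f)).
by rewrite mcoeff_apolZ; exact: linearZ.
Qed.

Lemma apol_map_comp (A B C : zmodType) (f : {additive B -> C})
  (g : {additive A -> B}) (p : {malg A[I]}) :
  apol_map f (apol_map g p) = apol_map (f \o g) p.
Proof. by apply/malgP => i; rewrite !apol_mapE /= ?raddf0. Qed.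

Lemma apol_map_id (A : zmodType) (p : {malg A[I]}) : apol_map id p = p.
Proof. by apply/malgP => i; rewrite apol_mapE. Qed.

End ApolMap.

Section LambdaOperators.
Variable F : fieldType.
Implicit Types A B : lmodType {poly F}.

Lemma mcoeff_lam A (p : lpoly A) n : (lam p)@_n = if n is k.+1 then p@_k else 0.
Proof.
rewrite /lam /apol_shift (raddf_sum (mcoeff n)) /=.
under eq_bigr => i _ do rewrite mcoeffU.
case: n => [|k]; first by rewrite big1.
have [kp|kNp] := boolP (k \in msupp p); last first.
  rewrite mcoeff_outdom // big_seq big1 // => i ip.
  by have [/succn_inj e|//] := eqVneq i.+1 k.+1; rewrite -e ip in kNp.
rewrite (big_fsetD1 k kp) /= eqxx big1_fset ?addr0 // => i.
by rewrite !inE eqSS => /andP[/negPf ->].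
Qed.

Lemma apol_map_lam A B (f : {linear A -> B}) (p : lpoly A) :
  apol_map f (lam p) = lam (apol_map f p : lpoly B).
Proof.
apply/malgP => -[|n]; rewrite apol_mapE ?raddf0 // !mcoeff_lam ?raddf0 //.
by rewrite apol_mapE ?raddf0.
Qed.

(** The substitution may be summed over any finite set containing the support;
    this lets two polynomials with different supports be compared term by term. *)
Lemma lsubstEw (A V : zmodType) (j : A -> V) (t : V -> V) (d : {fset nat})
    (p : {malg A[nat]}) :
    j 0 = 0 -> t 0 = 0 -> (msupp p `<=` d)%fset ->
  lsubst j t p = \sum_(n <- d) iter n t (j p@_n).
Proof.
move=> j0 t0 pd; apply: big_fset_incl => // n _ np.
by rewrite mcoeff_outdom // j0; elim: n {np} => //= n ->.
Qed.

Lemma lopp0 A : lopp (0 : lpoly A) = 0.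
Proof. by rewrite /lopp /lsubst msupp0 big_nil. Qed.

Lemma lam0 A : lam (0 : lpoly A) = 0.
Proof. by rewrite /lam /apol_shift msupp0 big_nil. Qed.

Lemma apol_map_lconst A B (f : {linear A -> B}) a :
  apol_map f (lconst a) = lconst (f a).
Proof. by apply/malgP => n; rewrite apol_mapE ?raddf0 // !mcoeffU raddfMn. Qed.

(** Substituting -λ-∂ for λ is natural in the module, because λ and ∂ both
    commute with an F[∂]-linear map; hence commutativity of a product passes to
    its images under linear maps. *)
Lemma apol_map_lopp A B (f : {linear A -> B}) (p : lpoly A) :
  apol_map f (lopp p) = lopp (apol_map f p : lpoly B).
Proof.
rewrite [RHS](@lsubstEw _ _ _ _ (msupp p)).
- rewrite /lopp /lsubst raddf_sum; apply: eq_bigr => n _.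
  rewrite apol_mapE ?raddf0 // -apol_map_lconst.
  elim: n (lconst _) => //= n IHn q.
  by rewrite raddfB raddfN /= apol_map_lam apol_mapZ IHn.
- by rewrite /lconst monalgU0.
- by rewrite lam0 scaler0 subr0 oppr0.
- apply/fsubsetP => n; apply: contraLR => np.
  by rewrite -mcoeff_eq0 apol_mapE ?raddf0 // mcoeff_outdom // raddf0.
Qed.

End LambdaOperators.

(** * Conformal bilinear maps *)

Section ConformalBilinear.
Variables (F : fieldType) (M N P : lmodType {poly F}).

Section Zmodule.
Variable f : M -> N -> lpoly P.
Hypothesis cf : conformal_bilinear f.

Lemma conformal_bilinearDl u u' v : f (u + u') v = f u v + f u' v.
Proof. by case: cf => /(_ 1 u u' v) + _ _ _; rewrite polyC1 !scale1r. Qed.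

Lemma conformal_bilinearDr u v v' : f u (v + v') = f u v + f u v'.
Proof. by case: cf => _ /(_ 1 u v v') + _ _; rewrite polyC1 !scale1r. Qed.

Lemma conformal_bilinear0l v : f 0 v = 0.
Proof. by apply: (@addIr _ (f 0 v)); rewrite -conformal_bilinearDl !add0r. Qed.

Lemma conformal_bilinear0r u : f u 0 = 0.
Proof. by apply: (@addIr _ (f u 0)); rewrite -conformal_bilinearDr !add0r. Qed.

End Zmodule.

(** Used both to read the blocks of a product on J ⊕ K as conformal bilinear
    maps and to transport a product along a linear map, so that the morphism
    property becomes an equality of two conformal bilinear maps. *)
Lemma conformal_bilinear_comp (M' N' P' : lmodType {poly F})
    (i : {linear M' -> M}) (j : {linear N' -> N}) (h : {linear P -> P'})
    (f : M -> N -> lpoly P) :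
    conformal_bilinear f ->
  conformal_bilinear (fun u v => apol_map h (f (i u) (j v)) : lpoly P').
Proof.
case=> linl linr sesl sesr; split=> [c u u' v|c u v v'|u v|u v].
- by rewrite linearP linl raddfD /= apol_mapZ.
- by rewrite linearP linr raddfD /= apol_mapZ.
- by rewrite linearZ sesl raddfN /= apol_map_lam.
- by rewrite linearZ sesr raddfD /= apol_map_lam apol_mapZ.
Qed.

End ConformalBilinear.

(** * The equivalence relations on extensions *)

Section ExtensionEquivalence.
Variables (F : fieldType) (J K : lmodType {poly F}) (mJ : jjca J).
Local Notation E := (J * K)%type.

Lemma linear_inverse (phi : {linear E -> E}) :
  bijective phi -> exists2 psi : {linear E -> E}, cancel phi psi & cancel psi phi.
Proof.
case=> g phiK gK.
pose gL := GRing.isLinear.Build _ _ _ _ g (GRing.can2_linear phiK gK).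
pose psi : {linear E -> E} := HB.pack g gL.
by exists psi.
Qed.

Lemma jjca_iso_id (m : jjca E) : jjca_iso m m idfun.
Proof. by split=> [|u v]; [exists idfun | rewrite apol_map_id]. Qed.

Lemma jjca_iso_comp (m m' m'' : jjca E) (phi psi : {linear E -> E}) :
  jjca_iso m m' phi -> jjca_iso m' m'' psi -> jjca_iso m m'' (psi \o phi).
Proof.
move=> [bphi phiM] [bpsi psiM]; split=> [|u v]; first exact: bij_comp.
by rewrite -psiM -phiM apol_map_comp.
Qed.

Lemma jjca_iso_inv (m m' : jjca E) (phi psi : {linear E -> E}) :
  cancel phi psi -> cancel psi phi -> jjca_iso m m' phi -> jjca_iso m' m psi.
Proof.
move=> phiK psiK [_ phiM]; split=> [|u v]; first by exists phi.
rewrite -[u in LHS]psiK -[v in LHS]psiK -phiM apol_map_comp.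
by rewrite (functional_extensionality _ _ phiK : psi \o phi = id) apol_map_id.
Qed.

Lemma equiv_ext_Equivalence : Equivalence (@equiv_ext F J K mJ).
Proof.
split=> [m|m m' [phi [iso st]]|m m' m'' [phi [iso st]] [psi [iso' st']]].
- by exists idfun; split=> //; apply: jjca_iso_id.
- have [psi phiK psiK] := linear_inverse iso.1.
  exists psi; split=> [|a]; first exact: jjca_iso_inv iso.
  by rewrite -[in LHS]st phiK.
- exists (psi \o phi); split=> [|a]; first exact: jjca_iso_comp iso iso'.
  by rewrite /= st st'.
Qed.

Lemma cohom_ext_Equivalence : Equivalence (@cohom_ext F J K mJ).
Proof.
split=> [m|m m' [phi [iso st co]]|m m' m'' [phi [iso st co]] [psi [iso' st' co']]].
- by exists idfun; split=> //; apply: jjca_iso_id.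
- have [psi phiK psiK] := linear_inverse iso.1.
  exists psi; split=> [|a|u]; first exact: jjca_iso_inv iso.
    by rewrite -[in LHS]st phiK.
  by rewrite -co psiK.
- exists (psi \o phi); split=> [|a|u]; first exact: jjca_iso_comp iso iso'.
    by rewrite /= st st'.
  by rewrite /= co' co.
Qed.

End ExtensionEquivalence.

(** * Triangular maps of the direct sum *)

Section DirectSum.
Variables (F : fieldType) (J K : lmodType {poly F}).
Local Notation E := (J * K)%type.

Lemma inJ_is_linear : linear (@inJ F J K).
Proof. by move=> c a b; congr pair; rewrite /= scaler0 addr0. Qed.

HB.instance Definition _ :=
  GRing.isLinear.Build {poly F} J E _ (@inJ F J K) inJ_is_linear.

Lemma inK_is_linear : linear (@inK F J K).
Proof. by move=> c a b; congr pair; rewrite /= scaler0 addr0. Qed.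

HB.instance Definition _ :=
  GRing.isLinear.Build {poly F} K E _ (@inK F J K) inK_is_linear.

Lemma split_sum (u : E) : u = inJ K u.1 + inK J u.2.
Proof. by case: u => a x; congr pair; rewrite ?addr0 ?add0r. Qed.

Lemma mcoeff_lpair (p : lpoly J) (q : lpoly K) n : (lpair p q)@_n = (p@_n, q@_n).
Proof.
by rewrite /lpair mcoeffD !apol_mapE //; congr pair; rewrite ?addr0 ?add0r.
Qed.

Lemma lpair_eta (p : lpoly E) : p = lpair (apol_map fst p) (apol_map snd p).
Proof.
by apply/malgP => n; rewrite mcoeff_lpair !apol_mapE //; case: (p@_n).
Qed.

Lemma lpair_inj (p p' : lpoly J) (q q' : lpoly K) :
  lpair p q = lpair p' q' -> p = p' /\ q = q'.
Proof.
move=> e; have en n : (p@_n, q@_n) = (p'@_n, q'@_n) by rewrite -!mcoeff_lpair e.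
by split; apply/malgP => n; case: (en n).
Qed.

Lemma apol_map_fst_inJ (p : lpoly J) : apol_map fst (apol_map (@inJ F J K) p) = p.
Proof. by apply/malgP => n; rewrite !apol_mapE. Qed.

Lemma apol_map_snd_inJ (p : lpoly J) : apol_map snd (apol_map (@inJ F J K) p) = 0.
Proof. by apply/malgP => n; rewrite !apol_mapE ?mcoeff0. Qed.

Definition triangular (r : K -> J) (s : K -> K) (u : E) : E := (u.1 + r u.2, s u.2).

Section Linear.
Variables (r : {linear K -> J}) (s : {linear K -> K}).

Lemma triangular_is_linear : linear (triangular r s).
Proof.
move=> c [a x] [b y]; congr pair; rewrite /= linearP //.
by rewrite scalerDr addrACA.
Qed.

HB.instance Definition _ :=
  GRing.isLinear.Build {poly F} E E _ (triangular r s) triangular_is_linear.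

Lemma triangular_inJ a : triangular r s (inJ K a) = inJ K a.
Proof. by rewrite /triangular /= !raddf0 addr0. Qed.

Lemma apol_map_triangular (p : lpoly J) (q : lpoly K) :
  apol_map (triangular r s) (lpair p q) = lpair (p + apol_map r q) (apol_map s q).
Proof.
apply/malgP => n; rewrite apol_mapE ?raddf0 // !mcoeff_lpair mcoeffD.
by rewrite !apol_mapE ?raddf0.
Qed.

(** The determinant criterion for a block triangular map with identity in the
    upper left corner; the inverse is (a, y) ↦ (a - r (s⁻¹ y), s⁻¹ y). *)
Lemma triangular_bij : bijective (triangular r s) <-> bijective s.
Proof.
split=> [[g phiK gK]|[t sK tK]].
  exists (fun y => (g (inK J y)).2) => [x|y].
    (* (0, s x) is the image of (- r x, x), so its preimage has K-component x *)
    have -> : inK J (s x) = triangular r s (- r x, x).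
      by rewrite /triangular /= addNr.
    by rewrite phiK.
  by rewrite -[RHS]/(inK J y).2 -[in RHS](gK (inK J y)).
exists (fun u => (u.1 - r (t u.2), t u.2)) => [[a x]|[a x]] /=.
  by rewrite /triangular /= sK addrK.
by rewrite /triangular /= tK subrK.
Qed.

End Linear.

(** Since phi (a, x) = (a, 0) + phi (0, x), the two components of phi on K are
    the only freedom left. *)
Lemma stabilizing_is_triangular (phi : {linear E -> E}) :
    stabilizesJ phi ->
  exists (r : {linear K -> J}) (s : {linear K -> K}), (phi : E -> E) = triangular r s.
Proof.
move=> st; exists (fst \o phi \o @inK F J K), (snd \o phi \o @inK F J K).
apply: functional_extensionality => u.
rewrite [in LHS](split_sum u) raddfD /= st.
by rewrite [phi _ in LHS]surjective_pairing; congr pair; rewrite /= add0r.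
Qed.

End DirectSum.

(** * Unified products and their morphisms *)

Section UnifiedProducts.
Variables (F : fieldType) (J K : lmodType {poly F}) (mJ : jjca J).
Local Notation E := (J * K)%type.

Lemma umul_inJ (U : extending_datum J K) a (v : E) :
  umul mJ U (inJ K a) v =
  lpair (mJ a v.1 + lopp (rhd U v.2 a)) (lopp (lhd U v.2 a)).
Proof.
case: v => b y; rewrite /umul /= !(conformal_bilinear0l (cbilinP _)).
by rewrite !addr0 add0r.
Qed.

Lemma umul_inK (U : extending_datum J K) x y :
  umul mJ U (inK J x) (inK J y) = lpair (omega U x y) (circ U x y).
Proof.
have [cJ _ _] := jjcaP mJ; rewrite /umul /= (conformal_bilinear0l cJ).
by rewrite !(conformal_bilinear0r (cbilinP _)) !lopp0 !addr0 !add0r.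
Qed.

(** The K × J block follows from the J × K block by commutativity, which is why
    the compatibility conditions come in two pairs and not in three. *)
Lemma commutative_product_ext (m m' : E -> E -> lpoly E) :
    conformal_bilinear m -> conformal_bilinear m' ->
    (forall u v, m u v = lopp (m v u)) ->
    (forall u v, m' u v = lopp (m' v u)) ->
    (forall a v, m (inJ K a) v = m' (inJ K a) v) ->
    (forall x y, m (inK J x) (inK J y) = m' (inK J x) (inK J y)) ->
  forall u v, m u v = m' u v.
Proof.
move=> cm cm' mC mC' eJ eK u v; rewrite (split_sum u) (split_sum v).
rewrite !(conformal_bilinearDl cm) !(conformal_bilinearDl cm') eJ.
rewrite !(conformal_bilinearDr cm) !(conformal_bilinearDr cm') eK.
by rewrite mC eJ -mC'.
Qed.

(** The J × K block yields the conditions on ⊳ and ⊲, the K × K block those on ω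
    and ∘; the J × J block is automatic.  In the J × K block the image
    (a, 0) ∗ (r x, s x) contributes the term a_λ r(x). *)
Lemma triangular_morphismP (U U' : extending_structure K mJ)
    (r : {linear K -> J}) (s : {linear K -> K}) :
  (forall u v, apol_map (triangular r s) (umul mJ U u v) =
               umul mJ U' (triangular r s u) (triangular r s v))
  <-> compatible mJ U U' r s.
Proof.
have [cU UC _] := datumP U; have [cU' UC' _] := datumP U'.
have inKE x : triangular r s (inK J x) = (r x, s x).
  by rewrite /triangular /= add0r.
split=> [phiM a x y|compat].
  have := phiM (inJ K a) (inK J x); rewrite triangular_inJ inKE !umul_inJ /=.
  rewrite apol_map_triangular => /lpair_inj[eJ eK].
  have := phiM (inK J x) (inK J y); rewrite !inKE umul_inK.
  rewrite apol_map_triangular => /lpair_inj[eJ' eK'].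
  split=> //; rewrite -eJ.
  by have [cJ _ _] := jjcaP mJ; rewrite (conformal_bilinear0r cJ) add0r.
pose m u v : lpoly E := apol_map (triangular r s) (umul mJ U u v).
pose m' u v : lpoly E :=
  apol_map idfun (umul mJ U' (triangular r s u) (triangular r s v)).
suff mm' : forall u v, m u v = m' u v.
  by move=> u v; rewrite -/(m u v) mm' /m' apol_map_id.
have cm : conformal_bilinear m.
  exact: (@conformal_bilinear_comp _ _ _ _ _ _ _ idfun idfun _ _ cU).
have cm' : conformal_bilinear m'.
  exact: (@conformal_bilinear_comp _ _ _ _ _ _ _ _ _ idfun _ cU').
have mC v w : m v w = lopp (m w v) by rewrite /m UC apol_map_lopp.
have mC' v w : m' v w = lopp (m' w v) by rewrite /m' UC' apol_map_lopp.
(* Testing on J × E instead of J × K avoids a separate J × J case. *)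
apply: commutative_product_ext cm cm' mC mC' _ _ => [a [b y]|x y].
  rewrite /m /m' apol_map_id triangular_inJ !umul_inJ apol_map_triangular /=.
  have [e1 e2 _ _] := compat a y y.
  rewrite -e2; congr lpair; rewrite -addrA e1 addrA.
  by have [cJ _ _] := jjcaP mJ; rewrite (conformal_bilinearDr cJ).
rewrite /m /m' apol_map_id umul_inK apol_map_triangular !inKE.
by have [_ _ -> ->] := compat 0 x y.
Qed.

Lemma jjca_iso_triangularP (U U' : extending_structure K mJ)
    (r : {linear K -> J}) (s : {linear K -> K}) :
  jjca_iso (unified_product U) (unified_product U') (triangular r s)
  <-> bijective s /\ compatible mJ U U' r s.
Proof. by rewrite /jjca_iso triangular_bij -triangular_morphismP. Qed.

Lemma equiv_structP (U U' : extending_structure K mJ) :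
  equiv_struct U U' <-> equiv_ext (unified_extension U) (unified_extension U').
Proof.
split=> [[r [s /jjca_iso_triangularP iso]]|[phi [iso st]]].
  by exists (triangular r s); split=> // a; apply: triangular_inJ.
have [r [s phiE]] := stabilizing_is_triangular st.
by exists r, s; apply/jjca_iso_triangularP; rewrite -phiE.
Qed.

Lemma cohom_structP (U U' : extending_structure K mJ) :
  cohom_struct U U' <-> cohom_ext (unified_extension U) (unified_extension U').
Proof.
split=> [[r compat]|[phi [iso st co]]].
  exists (triangular r idfun); split=> // [|a]; last exact: triangular_inJ.
  by apply/jjca_iso_triangularP; split; first by exists idfun.
have [r [s phiE]] := stabilizing_is_triangular st.
have sE : (s : K -> K) = id.
  apply: functional_extensionality => x.
  by have := congr1 (fun f => (f (inK J x)).2) phiE; rewrite /= co.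
exists r; rewrite -sE.
by have [|//] := (jjca_iso_triangularP U U' r s).1 _; rewrite -phiE.
Qed.

(** * Every extension is a unified product *)

Section DatumOfExtension.
Variable m : extension K mJ.

Let cm : conformal_bilinear m.
Proof. by case: (jjcaP m). Qed.

Definition datum_of_extension : extending_datum J K :=
  ExtendingDatum
    (CBilin (conformal_bilinear_comp (@inK F J K) (@inJ F J K) snd cm))
    (CBilin (conformal_bilinear_comp (@inK F J K) (@inJ F J K) fst cm))
    (CBilin (conformal_bilinear_comp (@inK F J K) (@inK F J K) fst cm))
    (CBilin (conformal_bilinear_comp (@inK F J K) (@inK F J K) snd cm)).

(** Expand m on J ⊕ K into its four blocks: the J × J block is the product of J
    because m extends it, and commutativity turns the J × K block into the
    -λ-∂ terms of the unified product. *)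
Lemma umul_datum_of_extension : umul mJ datum_of_extension = m.
Proof.
have [_ mC _] := jjcaP m.
apply: functional_extensionality => -[a x]; apply: functional_extensionality => -[b y].
rewrite (split_sum (a, x)) (split_sum (b, y)) !(conformal_bilinearDl cm).
rewrite !(conformal_bilinearDr cm) extP [m (inJ K a) (inK J y)]mC.
rewrite -!split_sum [RHS]lpair_eta !raddfD /= !apol_map_lopp.
rewrite apol_map_fst_inJ apol_map_snd_inJ add0r; congr lpair.
- by rewrite -addrA addrACA.
- by rewrite [RHS]addrCA addrA.
Qed.

Lemma datum_of_extensionP : is_extending_structure mJ datum_of_extension.
Proof. by rewrite /is_extending_structure umul_datum_of_extension; apply: jjcaP. Qed.

End DatumOfExtension.

(** The identity of J ⊕ K is the required isomorphism, so the finer relation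
    already holds. *)
Lemma unified_product_surj (m : extension K mJ) :
  exists U : extending_structure K mJ, cohom_ext (unified_extension U) m.
Proof.
exists (ExtendingStructure (datum_of_extensionP m)), idfun; split=> //.
split=> [|u v]; first by exists idfun.
by rewrite apol_map_id /= umul_datum_of_extension.
Qed.

End UnifiedProducts.

Theorem theorem4p5 (F : fieldType) (charF : [pchar F]%R =i pred0)
    (J K : lmodType {poly F}) (mJ : jjca J) :
  [/\ RelationClasses.Equivalence (@equiv_struct F J K mJ),
      RelationClasses.Equivalence (@equiv_ext F J K mJ)
    & exists Phi : H2J K mJ -> CExtd K mJ,
        (forall U : extending_structure K mJ,
           Phi (class (@equiv_struct F J K mJ) U)
           = class (@equiv_ext F J K mJ) (unified_extension U))
        /\ bijective Phi]
  /\
  [/\ RelationClasses.Equivalence (@cohom_struct F J K mJ),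
      RelationClasses.Equivalence (@cohom_ext F J K mJ)
    & exists Phi : H2 K mJ -> CExtd' K mJ,
        (forall U : extending_structure K mJ,
           Phi (class (@cohom_struct F J K mJ) U)
           = class (@cohom_ext F J K mJ) (unified_extension U))
        /\ bijective Phi].
Proof.
have eqE := @equiv_ext_Equivalence F J K mJ.
have eqC := @cohom_ext_Equivalence F J K mJ.
split; split=> //.
- exact: Equivalence_comap (@equiv_structP F J K mJ) eqE.
- apply: quot_map_bij (@equiv_structP F J K mJ) eqE _ => m.
  have [U [phi [iso st _]]] := unified_product_surj m.
  by exists U, phi.
- exact: Equivalence_comap (@cohom_structP F J K mJ) eqC.
- exact: quot_map_bij (@cohom_structP F J K mJ) eqC (@unified_product_surj F J K mJ).
Qed.
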